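(* Let $\mathbf{p}=(\boldsymbol{n}_1,\boldsymbol{n}_2,\boldsymbol{n}_3)$ be a smooth time-dependent field on $\Omega\subset\mathbb{R}^3$ with values in $SO(3)$ (columns $\boldsymbol{n}_1,\boldsymbol{n}_2,\boldsymbol{n}_3$). The system $$\chi_1\frac{\partial \boldsymbol{n}_2}{\partial t}\cdot\boldsymbol{n}_3+\mathscr{L}_1\mathcal{F}_{Bi}=0,\qquad \chi_2\frac{\partial \boldsymbol{n}_3}{\partial t}\cdot\boldsymbol{n}_1+\mathscr{L}_2\mathcal{F}_{Bi}=0,\qquad \chi_3\frac{\partial \boldsymbol{n}_1}{\partial t}\cdot\boldsymbol{n}_2+\mathscr{L}_3\mathcal{F}_{Bi}=0,\qquad \mathbf{p}=(\boldsymbol{n}_1,\boldsymbol{n}_2,\boldsymbol{n}_3)\in SO(3),$$ is equivalent to the generalised rotational form $$\frac{\partial\mathbf{p}}{\partial t}=\mathbf{p}\,\mathbf{A},\qquad \mathbf{p}=(\boldsymbol{n}_1,\boldsymbol{n}_2,\boldsymbol{n}_3)\in SO(3),$$ where $\mathbf{A}\in so(3)$ is given by $$\mathbf{A}=\begin{pmatrix}0&\frac1{\chi_3}\mathscr{L}_3\mathcal{F}_{Bi}[\mathbf{p}]&-\frac1{\chi_2}\mathscr{L}_2\mathcal{F}_{Bi}[\mathbf{p}]\\[2pt]-\frac1{\chi_3}\mathscr{L}_3\mathcal{F}_{Bi}[\mathbf{p}]&0&\frac1{\chi_1}\mathscr{L}_1\mathcal{F}_{Bi}[\mathbf{p}]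\\[2pt]\frac1{\chi_2}\mathscr{L}_2\mathcal{F}_{Bi}[\mathbf{p}]&-\frac1{\chi_1}\mathscr{L}_1\mathcal{F}_{Bi}[\mathbf{p}]&0\end{pmatrix}.$$
   Context: $SO(3)=\{\Lambda\in\mathbb{R}^{3\times3}:\Lambda^{\top}\Lambda=\mathbf{I},\ \det\Lambda=1\}$ and $so(3)=\{\Lambda\in\mathbb{R}^{3\times3}:\Lambda^{\top}+\Lambda=0\}$. The constants $\chi_1,\chi_2,\chi_3>0$ are diffusion coefficients. The biaxial elastic energy is $\mathcal{F}_{Bi}[\mathbf{p}]=\int_\Omega f_{Bi}(\mathbf{p},\nabla\mathbf{p})\,d\boldsymbol{x}$ with, for real constants $K_1,\dots,K_{12},\gamma_1,\gamma_2,\gamma_3$, $$\begin{aligned}f_{Bi}=\tfrac12\Big\{&K_1(\nabla\cdot\boldsymbol{n}_1)^2+K_2(\nabla\cdot\boldsymbol{n}_2)^2+K_3(\nabla\cdot\boldsymbol{n}_3)^2+K_4(\boldsymbol{n}_1\cdot\nabla\times\boldsymbol{n}_1)^2+K_5(\boldsymbol{n}_2\cdot\nabla\times\boldsymbol{n}_2)^2+K_6(\boldsymbol{n}_3\cdot\nabla\times\boldsymbol{n}_3)^2\\&+K_7(\boldsymbol{n}_3\cdot\nabla\times\boldsymbol{n}_1)^2+K_8(\boldsymbol{n}_1\cdot\nabla\times\boldsymbol{n}_2)^2+K_9(\boldsymbol{n}_2\cdot\nabla\times\boldsymbol{n}_3)^2\\&+K_{10}(\boldsymbol{n}_2\cdot\nabla\times\boldsymbol{n}_1)^2+K_{11}(\boldsymbol{n}_3\cdot\nabla\times\boldsymbol{n}_2)^2+K_{12}(\boldsymbol{n}_1\cdot\nabla\times\boldsymbol{n}_3)^2\\&+\sum_{i=1}^3\gamma_i\,\nabla\cdot\big[(\boldsymbol{n}_i\cdot\nabla)\boldsymbol{n}_i-(\nabla\cdot\boldsymbol{n}_i)\boldsymbol{n}_i\big]\Big\}.\end{aligned}$$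 The variational derivative $\frac{\delta\mathcal{F}_{Bi}}{\delta\boldsymbol{n}_i}=\frac{\partial f_{Bi}}{\partial\boldsymbol{n}_i}-\sum_k\partial_k\frac{\partial f_{Bi}}{\partial(\partial_k\boldsymbol{n}_i)}$ is the usual one, with $\boldsymbol{n}_1,\boldsymbol{n}_2,\boldsymbol{n}_3$ treated as independent vector fields, and $$\mathscr{L}_1\mathcal{F}=\boldsymbol{n}_3\cdot\frac{\delta\mathcal{F}}{\delta\boldsymbol{n}_2}-\boldsymbol{n}_2\cdot\frac{\delta\mathcal{F}}{\delta\boldsymbol{n}_3},\quad \mathscr{L}_2\mathcal{F}=\boldsymbol{n}_1\cdot\frac{\delta\mathcal{F}}{\delta\boldsymbol{n}_3}-\boldsymbol{n}_3\cdot\frac{\delta\mathcal{F}}{\delta\boldsymbol{n}_1},\quad \mathscr{L}_3\mathcal{F}=\boldsymbol{n}_2\cdot\frac{\delta\mathcal{F}}{\delta\boldsymbol{n}_1}-\boldsymbol{n}_1\cdot\frac{\delta\mathcal{F}}{\delta\boldsymbol{n}_2}.$$ All equations hold pointwise in $(\boldsymbol{x},t)$. *)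

(* Defs.v *)
From mathcomp Require Import all_boot all_order all_algebra.
From mathcomp Require Import ring.
From mathcomp Require Import boolp classical_sets functions reals topology.
From mathcomp Require Import normedtype landau derive.

Set Implicit Arguments.
Unset Strict Implicit.
Unset Printing Implicit Defensive.

Import Order.TTheory GRing.Theory Num.Theory.
Import numFieldNormedType.Exports.

Local Open Scope classical_set_scope.
Local Open Scope ring_scope.

(* [smooth_on U f]: all iterated directional derivatives of [f] exist and are
   Frechet differentiable (hence continuous) on [U].  For [U] open this is
   membership in the class C^oo. *)
Definition smooth_on (R : realType) (V W : normedModType R) (U : set V)
    (f : V -> W) : Prop :=
  forall (vs : seq V) (z : V), U z ->
    differentiable (foldr (fun v g => 'D_v g) f vs) z.

Definition SO3 (R : realType) : set 'M[R]_3 :=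
  [set L | L^T *m L = 1%:M /\ \det L = 1].

Definition so3 (R : realType) : set 'M[R]_3 := [set L | L^T + L = 0].

Section VectorCalculus.
Variable R : realType.
Local Notation vec := 'cV[R]_3.

Definition dotv (u v : vec) : R := \sum_j u j 0 * v j 0.

Definition partial (W : normedModType R) (k : 'I_3) (F : vec -> W) (x : vec) : W :=
  'D_(delta_mx k 0) F x.

(* Convention: (grad n x) k j = d_k n_j. *)
Definition grad (n : vec -> vec) (x : vec) : 'M[R]_3 :=
  \matrix_(k, j) partial k (fun y => n y j 0) x.

(* Divergence and curl as functions of a gradient matrix G k j = d_k n_j;
   indices of 'I_3 are added modulo 3, so the i-th component of the curl is
   d_(i+1) n_(i+2) - d_(i+2) n_(i+1). *)
Definition div_of (G : 'M[R]_3) : R := \tr G.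

Definition curl_of (G : 'M[R]_3) : vec :=
  \col_i (G (i + 1) (i + 2) - G (i + 2) (i + 1)).

(* The first-order form of div [(n.grad)n - (div n) n], in which the second
   derivatives of n cancel: see [saddle_splayE]. *)
Definition saddle_splay (G : 'M[R]_3) : R := \tr (G *m G) - (\tr G) ^+ 2.

Definition divergence (n : vec -> vec) (x : vec) : R := div_of (grad n x).

(* (n.grad)n = \sum_k n_k d_k n *)
Definition convection (n : vec -> vec) (x : vec) : vec :=
  \sum_k n x k 0 *: partial k n x.

End VectorCalculus.

Lemma is_derive_line (R : realType) (V W : normedModType R) (f : V -> W) y u (a : R) :
  derivable f (y + a *: u) u ->
  is_derive a 1 (fun s : R => f (y + s *: u)) ('D_u f (y + a *: u)).
Proof.
have E : (fun h : R => h^-1 *: (((fun s : R => f (y + s *: u)) \o shift a) (h *: 1)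
            - f (y + a *: u)))
       = (fun h => h^-1 *: ((f \o shift (y + a *: u)) (h *: u) - f (y + a *: u))).
  apply/funext => h /=.
  by rewrite [h *: 1]mulr1 scalerDl addrCA.
by move=> df; apply: DeriveDef; rewrite /derivable /derive E.
Qed.

Lemma derive_translate (R : realType) (V W : normedModType R) (f : V -> W) u w z :
  'D_u (fun y => f (y + w)) z = 'D_u f (z + w).
Proof.
rewrite /derive; set F := (F in lim (F @ _)); set G := (G in _ = lim (G @ _)).
by suff -> : F = G by []; apply/funext => k; rewrite /F /G/= addrA.
Qed.

Lemma MVT_line (R : realType) (V : normedModType R) (f : V -> R) y u (h : R) :
  0 < h -> (forall a, 0 <= a <= h -> differentiable f (y + a *: u)) ->
  exists2 a, 0 <= a <= h & f (y + h *: u) - f y = h * 'D_u f (y + a *: u).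
Proof.
move=> h0 df.
have D a : 0 <= a <= h ->
    is_derive a 1 (fun s : R => f (y + s *: u)) ('D_u f (y + a *: u)).
  by move=> /df/diff_derivable/is_derive_line.
have [||a] := @MVT R (fun s : R => f (y + s *: u)) (fun s => 'D_u f (y + s *: u)) 0 h h0.
- by move=> a; rewrite in_itv/= => /andP[/ltW a0 /ltW ah]; apply: D; rewrite a0.
- apply: derivable_within_continuous => a; rewrite in_itv/= => /D [].
  by [].
rewrite in_itv/= => /andP[/ltW a0 /ltW ah]; rewrite scale0r addr0 subr0 mulrC => ->.
by exists a; rewrite // a0.
Qed.

Lemma rectangle (R : realType) (V : normedModType R) (f : V -> R) x u v (h : R) :
  0 < h ->
  (forall a b, 0 <= a <= h -> 0 <= b <= h ->
     differentiable f (x + a *: u + b *: v) /\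
     differentiable ('D_u f) (x + a *: u + b *: v)) ->
  exists a b, [/\ 0 <= a <= h, 0 <= b <= h &
   f (x + h *: u + h *: v) - f (x + h *: u) - (f (x + h *: v) - f x)
     = h * (h * 'D_v ('D_u f) (x + a *: u + b *: v))].
Proof.
move=> h0 df; pose g y := f (y + h *: v) - f y.
have hh : 0 <= h <= h by rewrite lexx ltW.
have h00 : 0 <= (0 : R) <= h by rewrite lexx ltW.
have dfS a b : 0 <= a <= h -> 0 <= b <= h ->
    differentiable f (x + a *: u + b *: v) by move=> ? ?; exact: (df _ _ _ _).1.
have df0 a : 0 <= a <= h -> differentiable f (x + a *: u).
  by move=> ah; have := dfS a 0 ah h00; rewrite scale0r addr0.
have dS a : 0 <= a <= h -> differentiable (fun y => f (y + h *: v)) (x + a *: u).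
  move=> ah; apply: (@differentiable_comp _ _ _ _ (fun y : V => y + h *: v) f) => //.
  exact: dfS.
have dg a : 0 <= a <= h -> differentiable g (x + a *: u).
  by move=> ah; apply: differentiableB; [exact: dS | exact: df0].
have [a ah ga] := MVT_line h0 dg.
have {}ga : g (x + h *: u) - g x
    = h * ('D_u f (x + a *: u + h *: v) - 'D_u f (x + a *: u)).
  rewrite ga; congr (_ * _); have dSu := diff_derivable (v := u) (dS _ ah).
  have df0u := diff_derivable (v := u) (df0 _ ah).
  apply: etrans (deriveB dSu df0u) _; congr (_ - _).
  exact: derive_translate.
have [b bh gb] := MVT_line h0 (fun b bh => (df a b ah bh).2).
by exists a, b; split => //; rewrite -gb -ga.
Qed.

Lemma near_open (T : topologicalType) (U : set T) (x : T) :
  open U -> U x -> \forall y \near x, U y.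
Proof. by move=> Uo Ux; exact: open_nbhs_nbhs. Qed.

Lemma near_ball (R : realType) (V : normedModType R) (P : set V) (x : V) :
  nbhs x P -> exists2 d : R, 0 < d & ball x d `<=` P.
Proof. by move=> /(nbhs_ballP x P)[d /= d0 xd]; exists d. Qed.

(* Symmetry of the second derivatives of a function of class C^2. *)
Lemma derive_comm (R : realType) (V : normedModType R) (U : set V)
    (f : V -> R) (u v x : V) :
  open U -> smooth_on U f -> U x -> 'D_v ('D_u f) x = 'D_u ('D_v f) x.
Proof.
move=> Uo fs Ux.
have cuv : {for x, continuous ('D_v ('D_u f))}.
  exact/differentiable_continuous/(fs [:: v; u]).
have cvu : {for x, continuous ('D_u ('D_v f))}.
  exact/differentiable_continuous/(fs [:: u; v]).
apply/eqP; rewrite -subr_eq0 -normr_eq0; apply/negPn/negP => D0.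
set D := `|_| in D0; have {}D0 : 0 < D by rewrite lt0r D0 normr_ge0.
have e0 : 0 < D / 2 by rewrite divr_gt0.
move/cvgrPdist_lt : cuv => /(_ _ e0) cuv.
move/cvgrPdist_lt : cvu => /(_ _ e0) cvu.
have [d d0 xd] := near_ball (filterI (near_open Uo Ux) (filterI cuv cvu)).
pose h := d / (`|u| + `|v| + 1).
have s0 : 0 < `|u| + `|v| + 1 by rewrite ltr_wpDl// addr_ge0.
have h0 : 0 < h by rewrite divr_gt0.
have inb a b : 0 <= a <= h -> 0 <= b <= h -> ball x d (x + a *: u + b *: v).
  move=> /andP[a0 ah] /andP[b0 bh]; rewrite -ball_normE/= -addrA opprD addNKr normrN.
  rewrite (le_lt_trans (ler_normD _ _))// !normrZ !ger0_norm//.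
  rewrite (@le_lt_trans _ _ (h * (`|u| + `|v|)))//.
    by rewrite mulrDr lerD// ler_wpM2r.
  by rewrite /h mulrAC ltr_pdivrMr// ltr_pM2l// ltrDl.
have [a [b [ah bh E1]]] := rectangle (f := f) (x := x) (u := u) (v := v) h0
  (fun a b ah bh => let: conj Uy _ := xd _ (inb a b ah bh) in
     conj (fs [::] _ Uy) (fs [:: u] _ Uy)).
have inb' b' a' : 0 <= b' <= h -> 0 <= a' <= h -> ball x d (x + b' *: v + a' *: u).
  by move=> ? ?; rewrite addrAC; exact: inb.
have [b' [a' [bh' ah' E2]]] := rectangle (f := f) (x := x) (u := v) (v := u) h0
  (fun a b ah bh => let: conj Uy _ := xd _ (inb' a b ah bh) in
     conj (fs [::] _ Uy) (fs [:: v] _ Uy)).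
have swap (r1 r2 r3 r4 : R) : r1 - r2 - (r3 - r4) = r1 - r3 - (r2 - r4) by ring.
have [_ [B1 _]] := xd _ (inb _ _ ah bh).
have [_ [_ B2]] := xd _ (inb' _ _ bh' ah').
have S : f (x + h *: u + h *: v) - f (x + h *: u) - (f (x + h *: v) - f x)
       = f (x + h *: v + h *: u) - f (x + h *: v) - (f (x + h *: u) - f x).
  by rewrite (addrAC x); exact: swap.
have E := etrans (esym E1) (etrans S E2).
have {}E := mulfI (lt0r_neq0 h0) (mulfI (lt0r_neq0 h0) E).
rewrite E in B1; rewrite distrC in B2.
have := le_lt_trans (ler_distD _ _ _) (ltrD B1 B2).
by rewrite -/D -splitr ltxx.
Qed.

Lemma near_eq_differentiable (R : realType) (V W : normedModType R)
    (f g : V -> W) (x : V) :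
  (\near x, f x = g x) -> differentiable f x -> differentiable g x.
Proof.
move=> fg df; have fxgx := nbhs_singleton fg.
have E : g \o shift x = cst (g x) + 'd f x +o_ (0 : V) id.
  apply/eqaddoP => e e0.
  have /eqaddoP/(_ e e0) := diff_locally df.
  apply: filterS2; last by have := fg; rewrite (near_shift 0)/=; exact.
  by move=> y; rewrite !fctE/= subr0 => fgy; rewrite -fxgx -fgy.
apply/diff_locallyP.
have D : 'd g x = 'd f x :> (V -> W) by apply: diff_unique => //; exact: diff_continuous.
by rewrite D; split => //; exact: diff_continuous.
Qed.

Lemma iter_derive_coord (R : realType) (V : normedModType R) (m n : nat)
    (U : set V) (f : V -> 'M[R]_(m.+1, n.+1)) i j (vs : seq V) :
  open U -> smooth_on U f -> forall z, U z ->
  foldr (fun v (g : V -> R) => 'D_v g) (fun y => f y i j) vs z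
  = foldr (fun v (g : V -> 'M_(_, _)) => 'D_v g) f vs z i j.
Proof.
move=> Uo fs; elim: vs => //= v vs IH z Uz.
rewrite derive_mx ?mxE; last exact/diff_derivable/fs.
apply: near_eq_derive; near=> y; apply: IH; near: y; exact: near_open.
Unshelve. all: by end_near. Qed.

Lemma smooth_coord (R : realType) (V : normedModType R) (m n : nat)
    (U : set V) (f : V -> 'M[R]_(m.+1, n.+1)) i j :
  open U -> smooth_on U f -> smooth_on U (fun y => f y i j).
Proof.
move=> Uo fs vs z Uz.
apply: (@near_eq_differentiable _ _ _
  (fun y => foldr (fun v (g : V -> 'M_(_, _)) => 'D_v g) f vs y i j)).
  near=> y; apply/esym/(iter_derive_coord _ _ _ Uo fs).
  near: y; exact: near_open.
apply: (@differentiable_comp _ _ _ _ _ (fun N : 'M[R]_(_, _) => N i j : R)).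
  exact: fs.
exact: differentiable_coord.
Unshelve. all: by end_near. Qed.

Lemma saddle_splay_algebra (R : realType) (N : 'I_3 -> R) (g : 'I_3 -> 'I_3 -> R)
    (h : 'I_3 -> 'I_3 -> 'I_3 -> R) :
  (forall k l j, h k l j = h l k j) ->
  \sum_k (\sum_l (N l * h k l k + g l k * g k l)
          - ((\sum_l g l l) * g k k + \sum_l N k * h k l l))
  = \sum_k \sum_l g k l * g l k - (\sum_l g l l) ^+ 2.
Proof.
move=> hC; under eq_bigr do rewrite big_split/=.
have E : \sum_k \sum_l N l * h k l k = \sum_k \sum_l N k * h k l l.
  rewrite exchange_big/=; apply: eq_bigr => k _; apply: eq_bigr => l _.
  by rewrite hC.
rewrite sumrB !big_split/= E opprD [- _ - _]addrC addrACA subrr add0r.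
rewrite -mulr_sumr expr2; congr (_ - _).
by apply: eq_bigr => k _; apply: eq_bigr => l _; rewrite mulrC.
Qed.

Lemma saddle_splayE (R : realType) (Omega : set 'cV[R]_3)
    (n : 'cV[R]_3 -> 'cV[R]_3) (x : 'cV[R]_3) :
  open Omega -> smooth_on Omega n -> Omega x ->
  divergence (fun y => convection n y - divergence n y *: n y) x
  = saddle_splay (grad n x).
Proof.
move=> Oo ns Ox; pose N j := fun y : 'cV[R]_3 => n y j 0.
pose e k : 'cV[R]_3 := delta_mx k 0.
have Ns j : smooth_on Omega (N j) by exact: smooth_coord.
have dN j k y : Omega y -> derivable (N j) y (e k).
  by move=> Oy; exact/diff_derivable/(Ns j [::]).
have ddN j k l : derivable ('D_(e l) (N j)) x (e k).
  by exact/diff_derivable/(Ns j [:: e l]).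
have F k : \forall y \near x,
   (convection n y - divergence n y *: n y) k 0
   = (\sum_l N l * 'D_(e l) (N k) - (\sum_l 'D_(e l) (N l)) * N k) y.
  apply: filterS (near_open Oo Ox) => y Oy.
  rewrite !mxE summxE !fctE.
  rewrite !fct_sumE.
  congr (_ - _).
    apply: eq_bigr => l _; rewrite !mxE; congr (_ * _).
    by rewrite /partial derive_mx ?mxE//; exact/diff_derivable/(ns [::]).
  congr (_ * _); apply: eq_bigr => l _; rewrite !mxE.
  by [].
rewrite /divergence /div_of /mxtrace.
under eq_bigr => k _ do rewrite mxE /partial (near_eq_derive _ (F k)) -/(e k).
have dM (f g : 'cV[R]_3 -> R) v : derivable f x v -> derivable g x v ->
    'D_v (f * g) x = f x * 'D_v g x + g x * 'D_v f x.
  exact: deriveM.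
pose g k j := 'D_(e k) (N j) x.
have G k l : derivable (N l * 'D_(e l) (N k)) x (e k) by
  exact: derivableM (dN _ _ _ Ox) (ddN _ _ _).
have Dsum k : derivable (\sum_l 'D_(e l) (N l)) x (e k) by exact: derivable_sum.
have Dk k : 'D_(e k) (\sum_l N l * 'D_(e l) (N k) - (\sum_l 'D_(e l) (N l)) * N k) x
  = (\sum_l (N l x * 'D_(e k) ('D_(e l) (N k)) x + g l k * g k l))
    - ((\sum_l g l l) * g k k + \sum_l N k x * 'D_(e k) ('D_(e l) (N l)) x).
  rewrite deriveB; last 2 first.
  - by apply: derivable_sum => l; exact: G.
  - by apply: derivableM => //; exact: dN.
  rewrite (derive_sum (G k)); congr (_ - _).
    by apply: eq_bigr => l _; rewrite dM//; exact: dN.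
  rewrite dM//; last exact: dN.
  by rewrite (derive_sum (fun l => ddN l k l)) fct_sumE mulr_sumr.
under eq_bigr => k _ do rewrite Dk.
rewrite (saddle_splay_algebra (fun j => N j x) g
  (h := fun k l j => 'D_(e k) ('D_(e l) (N j)) x)); last first.
  by move=> k l j; exact: (derive_comm _ _ Oo (Ns j) Ox).
rewrite /saddle_splay /mxtrace; congr (_ - _).
  apply: eq_bigr => k _; rewrite mxE; apply: eq_bigr => l _.
  by rewrite !mxE.
by congr (_ ^+ 2); apply: eq_bigr => k _; rewrite !mxE.
Qed.

Record elastic_constants (R : Type) := ElasticConstants {
  K1 : R; K2 : R; K3 : R; K4 : R; K5 : R; K6 : R;
  K7 : R; K8 : R; K9 : R; K10 : R; K11 : R; K12 : R;
  gamma : 'I_3 -> R }.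

Section BiaxialEnergy.
Variable R : realType.
Local Notation vec := 'cV[R]_3.

(* A Lagrangian density depends on the frame P = (n_1, n_2, n_3), given by its
   columns, and on the gradients G i = grad n_i.  The frame vectors n_1, n_2,
   n_3 are the columns of index 0, 1, 2. *)
Definition lagrangian := 'M[R]_3 -> ('I_3 -> 'M[R]_3) -> R.

Definition fBi (c : elastic_constants R) : lagrangian := fun P G =>
  let n1 := col 0 P in let n2 := col 1 P in let n3 := col 2 P in
  let curl1 := curl_of (G 0) in
  let curl2 := curl_of (G 1) in
  let curl3 := curl_of (G 2) in
  2^-1 *
  (K1 c * div_of (G 0) ^+ 2 + K2 c * div_of (G 1) ^+ 2 + K3 c * div_of (G 2) ^+ 2
   + K4 c * dotv n1 curl1 ^+ 2 + K5 c * dotv n2 curl2 ^+ 2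
   + K6 c * dotv n3 curl3 ^+ 2
   + K7 c * dotv n3 curl1 ^+ 2 + K8 c * dotv n1 curl2 ^+ 2
   + K9 c * dotv n2 curl3 ^+ 2
   + K10 c * dotv n2 curl1 ^+ 2 + K11 c * dotv n3 curl2 ^+ 2
   + K12 c * dotv n1 curl3 ^+ 2
   + \sum_i gamma c i * saddle_splay (G i)).

Definition frame_grad (p : vec -> 'M[R]_3) (x : vec) : 'I_3 -> 'M[R]_3 :=
  fun i => grad (fun y => col i (p y)) x.

(* d f / d n_i, a vector. *)
Definition dL_dn (f : lagrangian) (i : 'I_3) (P : 'M[R]_3)
    (G : 'I_3 -> 'M[R]_3) : vec :=
  \col_j 'D_(delta_mx j i) (fun Q => f Q G) P.

(* d f / d (d_k n_i), a vector: only the i-th gradient varies. *)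
Definition dL_dgrad (f : lagrangian) (i k : 'I_3) (P : 'M[R]_3)
    (G : 'I_3 -> 'M[R]_3) : vec :=
  \col_j 'D_(delta_mx k j) (fun X => f P (fun i' => if i' == i then X else G i')) (G i).

Definition variational_derivative (f : lagrangian) (i : 'I_3)
    (p : vec -> 'M[R]_3) (x : vec) : vec :=
  dL_dn f i (p x) (frame_grad p x)
  - \sum_k partial k (fun y => dL_dgrad f i k (p y) (frame_grad p y)) x.

Definition L1 (f : lagrangian) (p : vec -> 'M[R]_3) (x : vec) : R :=
  dotv (col 2 (p x)) (variational_derivative f 1 p x)
  - dotv (col 1 (p x)) (variational_derivative f 2 p x).

Definition L2 (f : lagrangian) (p : vec -> 'M[R]_3) (x : vec) : R :=
  dotv (col 0 (p x)) (variational_derivative f 2 p x)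
  - dotv (col 2 (p x)) (variational_derivative f 0 p x).

Definition L3 (f : lagrangian) (p : vec -> 'M[R]_3) (x : vec) : R :=
  dotv (col 1 (p x)) (variational_derivative f 0 p x)
  - dotv (col 0 (p x)) (variational_derivative f 1 p x).

Definition dt (W : normedModType R) (g : R -> W) : R -> W := 'D_1 g.

Definition frame_system (c : elastic_constants R) (chi1 chi2 chi3 : R)
    (I : set R) (Omega : set vec) (p : R -> vec -> 'M[R]_3) : Prop :=
  forall (t : R) (x : vec), I t -> Omega x ->
  [/\ chi1 * dotv (dt (fun s => col 1 (p s x)) t) (col 2 (p t x))
        + L1 (fBi c) (p t) x = 0,
      chi2 * dotv (dt (fun s => col 2 (p s x)) t) (col 0 (p t x))
        + L2 (fBi c) (p t) x = 0,
      chi3 * dotv (dt (fun s => col 0 (p s x)) t) (col 1 (p t x))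
        + L3 (fBi c) (p t) x = 0
    & SO3 (p t x)].

Definition rotation_generator (c : elastic_constants R) (chi1 chi2 chi3 : R)
    (p : vec -> 'M[R]_3) (x : vec) : 'M[R]_3 :=
  let l1 := chi1^-1 * L1 (fBi c) p x in
  let l2 := chi2^-1 * L2 (fBi c) p x in
  let l3 := chi3^-1 * L3 (fBi c) p x in
  \matrix_(i, j) (nth [::] [:: [::   0;  l3; - l2];
                               [:: - l3;  0;   l1];
                               [::   l2; - l1;  0]] i)`_j.

Definition rotational_form (c : elastic_constants R) (chi1 chi2 chi3 : R)
    (I : set R) (Omega : set vec) (p : R -> vec -> 'M[R]_3) : Prop :=
  forall (t : R) (x : vec), I t -> Omega x ->
  dt (fun s => p s x) t
    = p t x *m rotation_generator c chi1 chi2 chi3 (p t) x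
  /\ SO3 (p t x).

End BiaxialEnergy.

(* Main.v *)
Require Import Defs.
From mathcomp Require Import all_boot all_order all_algebra.
From mathcomp Require Import boolp classical_sets functions reals topology normedtype derive.

Set Implicit Arguments.
Unset Strict Implicit.
Unset Printing Implicit Defensive.

Import Order.TTheory GRing.Theory Num.Theory.
Import numFieldNormedType.Exports.
Local Open Scope classical_set_scope.
Local Open Scope ring_scope.

(* The entries of S = p^T p' are the products n_i . n_j'.  Differentiating
   p^T p = 1 shows that S is antisymmetric, so S is determined by its entries
   (3, 2), (1, 3) and (2, 1).  The three scalar equations say that these entries
   agree with those of the antisymmetric matrix A; hence they are equivalent to
   S = A, which is p' = p A because p is orthogonal. *)

Lemma so3P (R : realType) (L : 'M[R]_3) :
  so3 L <-> forall i j, L i j = - L j i.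
Proof.
rewrite /so3 /=; split => [/matrixP L0 i j|LN].
  by move: (L0 j i); rewrite !mxE => /eqP; rewrite addr_eq0 => /eqP.
by apply/matrixP => i j; rewrite !mxE LN addNr.
Qed.

(** Indices start at 0. One entry is taken from each transposed pair, on the side where S = p^T p'
    contains n_3 . n_2', n_1 . n_3' and n_2 . n_1'. *)
Lemma so3_eqP (R : realType) (S A : 'M[R]_3) : so3 S -> so3 A ->
  S = A <-> [/\ S 2 1 = A 2 1, S 0 2 = A 0 2 & S 1 0 = A 1 0].
Proof.
move=> /so3P SN /so3P AN; split => [->//|[e21 e02 e10]].
(* A diagonal entry equals its own opposite, so it is 0 in the ordered field [R]. *)
have diag0 (L : 'M[R]_3) i : (forall i j, L i j = - L j i) -> L i i = 0.
  by move=> LN; apply/eqP; rewrite -eqNr -LN.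
have I3 (i : 'I_3) : [\/ i = 0, i = 1 | i = 2].
  by case: i => [[|[|[|//]]] ?]; [constructor 1|constructor 2|constructor 3];
    exact/val_inj.
apply/matrixP => i j.
case: (I3 i) => ->; case: (I3 j) => ->; rewrite ?(diag0 S) ?(diag0 A) //.
- by rewrite SN AN e10.
- by rewrite SN AN e21.
- by rewrite SN AN e02.
Qed.

Lemma rotation_generator_so3 (R : realType) (c : elastic_constants R)
    (chi1 chi2 chi3 : R) (p : 'cV[R]_3 -> 'M[R]_3) (x : 'cV[R]_3) :
  so3 (rotation_generator c chi1 chi2 chi3 p x).
Proof.
apply/so3P => i j; rewrite !mxE.
by case: i j => [[|[|[|//]]] ?] [[|[|[|//]]] ?] /=; rewrite ?oppr0 ?opprK.
Qed.

Section GeneratorEntries.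
Variables (R : realType) (c : elastic_constants R) (chi1 chi2 chi3 : R).
Variables (p : 'cV[R]_3 -> 'M[R]_3) (x : 'cV[R]_3).
Local Notation A := (rotation_generator c chi1 chi2 chi3 p x).

Lemma rotation_generator21 : A 2 1 = - (chi1^-1 * L1 (fBi c) p x).
Proof. by rewrite mxE. Qed.

Lemma rotation_generator02 : A 0 2 = - (chi2^-1 * L2 (fBi c) p x).
Proof. by rewrite mxE. Qed.

Lemma rotation_generator10 : A 1 0 = - (chi3^-1 * L3 (fBi c) p x).
Proof. by rewrite mxE. Qed.

End GeneratorEntries.

Section FrameCurve.
Variables (R : realType) (q : R -> 'M[R]_3) (t : R).
Hypothesis dq : derivable q t 1.

Lemma derivable_entry i j : derivable (fun s => q s i j) t 1.
Proof. exact: (derivable_mxP _ _ _).1. Qed.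

Lemma dt_entry i j : dt (fun s => q s i j) t = dt q t i j.
Proof. by rewrite /dt derive_mx // mxE. Qed.

Lemma dt_col j : dt (fun s => col j (q s)) t = col j (dt q t).
Proof.
rewrite /dt derive_mx; last first.
  by apply/(derivable_mxP _ _ _).2 => i k; under eq_fun do rewrite mxE; exact: derivable_entry.
apply/matrixP => i k; rewrite !mxE -/(dt q t) -dt_entry.
by under eq_fun do rewrite mxE.
Qed.

(** Turns the time-derivative term of each scalar equation into an entry of p^T p'. *)
Lemma dot_dt_col i j :
  dotv (dt (fun s => col j (q s)) t) (col i (q t)) = ((q t)^T *m dt q t) i j.
Proof.
by rewrite dt_col /dotv mxE; apply: eq_bigr => k _; rewrite !mxE mulrC.
Qed.

(** Product rule for an entry of q^T q, which is constant near t; orthogonality at t alone would say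
    nothing about the derivative. *)
Lemma velocity_so3 : (\near t, SO3 (q t)) -> so3 ((q t)^T *m dt q t).
Proof.
move=> qSO; apply/so3P => i j; apply/eqP; rewrite -addr_eq0; apply/eqP.
pose f k : R -> R := fun s => q s k i; pose g k : R -> R := fun s => q s k j.
have df k : derivable (f k) t 1 by exact: derivable_entry.
have dg k : derivable (g k) t 1 by exact: derivable_entry.
have near_cst : \near t, (\sum_k f k * g k) t = cst ((1%:M : 'M[R]_3) i j) t.
  apply: filterS qSO => s [/matrixP/(_ i j) <- _].
  by rewrite fct_sumE mxE; apply: eq_bigr => k _; rewrite !mxE.
have := near_eq_derive (1 : R) near_cst.
(* The 0 of the goal becomes the differentiated sum, to be compared term by term. *)
rewrite derive_cst (derive_sum (fun k => derivableM (df k) (dg k))) => <-.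
rewrite !mxE -big_split /=; apply: eq_bigr => k _.
by rewrite deriveM // !mxE -!dt_entry.
Qed.

End FrameCurve.

Lemma derivable_time (R : realType) (V W : normedModType R) (I : set R)
    (Omega : set V) (p : R -> V -> W) t x :
  smooth_on (I `*` Omega) (fun z : R * V => p z.1 z.2) -> I t -> Omega x ->
  derivable (fun s => p s x) t 1.
Proof.
move=> ps It Ox; apply: diff_derivable.
(* Chain rule along s -> (s, x); the empty list of directions in [smooth_on] gives differentiability
   of the field itself. *)
apply: (@differentiable_comp _ _ _ _ (fun s : R => (s, x))
  (fun z : R * V => p z.1 z.2)); last exact: (ps [::] (t, x)).
exact: differentiable_pair.
Qed.

(** A left inverse of a square matrix is also a right inverse. *)
Lemma orthogonal_mulmx_eq (R : comUnitRingType) n (P Q A : 'M[R]_n) :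
  P^T *m P = 1%:M -> Q = P *m A <-> P^T *m Q = A.
Proof.
move=> PP; split => [->|<-]; first by rewrite mulmxA PP mul1mx.
by rewrite mulmxA (mulmx1C PP) mul1mx.
Qed.

(** An equality of propositions, so that one [rewrite] solves all three scalar equations for their
    derivative terms. *)
Lemma addM_eq0 (F : fieldType) (a u l : F) :
  a != 0 -> (a * u + l = 0) = (u = - (a^-1 * l)).
Proof.
move=> a0; apply/propext; split => [/eqP|->]; last by rewrite mulrN mulVKf // addNr.
by rewrite addr_eq0 => /eqP e; rewrite -mulrN -e mulKf.
Qed.

Theorem proposition2p1 (R : realType) (c : elastic_constants R)
    (chi1 chi2 chi3 : R) (I : set R) (Omega : set 'cV[R]_3)
    (p : R -> 'cV[R]_3 -> 'M[R]_3)
    (chi1_gt0 : 0 < chi1) (chi2_gt0 : 0 < chi2) (chi3_gt0 : 0 < chi3)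
    (I_open : open I) (Omega_open : open Omega)
    (p_smooth : smooth_on (I `*` Omega) (fun z : R * 'cV[R]_3 => p z.1 z.2))
    (p_SO3 : forall t x, I t -> Omega x -> SO3 (p t x)) :
  (forall t x, I t -> Omega x ->
     so3 (rotation_generator c chi1 chi2 chi3 (p t) x)) /\
  (frame_system c chi1 chi2 chi3 I Omega p <->
   rotational_form c chi1 chi2 chi3 I Omega p).
Proof.
split; first by move=> *; exact: rotation_generator_so3.
have pointwise t x : I t -> Omega x ->
  [/\ chi1 * dotv (dt (fun s => col 1 (p s x)) t) (col 2 (p t x))
        + L1 (fBi c) (p t) x = 0,
      chi2 * dotv (dt (fun s => col 2 (p s x)) t) (col 0 (p t x))
        + L2 (fBi c) (p t) x = 0 &
      chi3 * dotv (dt (fun s => col 0 (p s x)) t) (col 1 (p t x))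
        + L3 (fBi c) (p t) x = 0] <->
  dt (fun s => p s x) t
    = p t x *m rotation_generator c chi1 chi2 chi3 (p t) x.
  move=> It Ox; have dp := derivable_time p_smooth It Ox.
  have Sso : so3 ((p t x)^T *m dt (fun s => p s x) t).
    apply: velocity_so3 => //.
    (* With x fixed, openness of [I] keeps the frame in SO(3) at all times near t. *)
    by apply: filterS (near_open I_open It) => s Is; exact: p_SO3.
  rewrite (orthogonal_mulmx_eq _ _ (proj1 (p_SO3 _ _ It Ox))).
  rewrite (so3_eqP Sso (rotation_generator_so3 _ _ _ _ _ _)).
  rewrite rotation_generator21 rotation_generator02 rotation_generator10.
  (* What remains holds for arbitrary values of the three variational terms. *)
  move: (L1 _ _ _) (L2 _ _ _) (L3 _ _ _) => l1 l2 l3.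
  by rewrite !(dot_dt_col dp) !addM_eq0 // lt0r_neq0.
split => H t x It Ox; have [] := H t x It Ox.
  by move=> e1 e2 e3 pSO; split => //; apply/pointwise.
by move=> /(pointwise _ _ It Ox)[e1 e2 e3] pSO; split.
Qed.
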